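(* Let $n\ge 2$ and $r\ge 1$ be integers. Assume that $w\in\mathbf{F}_r\ast S_n$ is strong and induces a constant map $S_n^r\to S_n$. Then either $w\in S_n$ or $\ell(w)\ge \frac n2$.
   Context: $\mathbf{F}_r=\langle x_1,\dots,x_r\rangle$ is the free group on $x_1,\dots,x_r$, $S_n$ is the symmetric group on $n$ points, and $\ast$ denotes the free product. An element $w\in\mathbf{F}_r\ast S_n$ induces a word map with constants $w\colon S_n^r\to S_n$, where $w(g_1,\dots,g_r)$ is the image of $w$ under the unique homomorphism $\mathbf{F}_r\ast S_n\to S_n$ that is the identity on $S_n$ and maps $x_i\mapsto g_i$. Normal form: every $w\in\mathbf{F}_r\ast S_n$ can be written uniquely as $w=c_0x_{i(1)}^{\varepsilon(1)}c_1\cdots c_{l-1}x_{i(l)}^{\varepsilon(l)}c_l$ with $l\ge 0$, $i(j)\in\{1,\dots,r\}$, $\varepsilon(j)=\pm1$, $c_j\in S_n$, and without cancellation: if $i(j)=i(j+1)$ and $\varepsilon(j)=-\varepsilon(j+1)$ then $c_j\ne 1$ ($1\le j\le l-1$). The length of $w$ is $\ell(w)=l$. The word $w$ is strong if, when written in normal form, removing the constants does not lead to any cancellation among the variables, i.e. there is no $j\in\{1,\dots,l-1\}$ with $i(j)=i(j+1)$ and $\varepsilon(j)=-\varepsilon(j+1)$. *)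

(* Defs.v *)
From HB Require Import structures.
From mathcomp Require Import all_boot all_fingroup.

Set Implicit Arguments.
Unset Strict Implicit.
Unset Printing Implicit Defensive.

Local Open Scope group_scope.

(* The free product F_r * G of the free group on x_0, ..., x_(r-1) with a     *)
(* group G, realised on the set of normal forms c_0 y_1 c_1 ... y_l c_l.      *)
(* That this is the free product is witnessed by fplift_unique (universal     *)
(* property) and by fp_normal_form and fp_normal_form_uniq (existence and     *)
(* uniqueness of the normal form).                                            *)
Section FreeProduct.
Variables (r : nat) (G : groupType).

(* (i, false) stands for x_i and (i, true) for x_i^-1. *)
Definition letter := ('I_r * bool)%type.
Definition flip (y : letter) : letter := (y.1, ~~ y.2).

(* A pair (y_j, c_j): a letter together with the constant that follows it. *)
Definition syllable := (letter * G)%type.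

(* The word c_0 y_1 c_1 ... y_l c_l is (c_0, [:: (y_1, c_1); ...]). *)
Definition rawword := (G * seq syllable)%type.

Definition reduced (w : rawword) : bool :=
  sorted (fun a b : syllable => ~~ ((b.1 == flip a.1) && (a.2 == 1))) w.2.

Definition rconst (c : G) (w : rawword) : rawword := (c * w.1, w.2).

Definition rletter (y : letter) (w : rawword) : rawword :=
  if w.2 is a :: s then
    if (a.1 == flip y) && (w.1 == 1) then (a.2, s) else (1, (y, w.1) :: w.2)
  else (1, (y, w.1) :: w.2).

Definition rmul (u v : rawword) : rawword :=
  rconst u.1 (foldr (fun a w => rletter a.1 (rconst a.2 w)) v u.2).

Definition rinv (u : rawword) : rawword :=
  foldl (fun w a => rconst a.2^-1 (rletter (flip a.1) w)) (u.1^-1, [::]) u.2.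

Lemma flipK : involutive flip.
Proof. by case=> i b; rewrite /flip negbK. Qed.

Lemma rconst1 w : rconst 1 w = w.
Proof. by case: w => c s; rewrite /rconst mul1g. Qed.

Lemma rconstM c d w : rconst c (rconst d w) = rconst (c * d) w.
Proof. by rewrite /rconst /= mulgA. Qed.

Lemma reduced_rconst c w : reduced (rconst c w) = reduced w.
Proof. by []. Qed.

Lemma reduced_rletter y w : reduced w -> reduced (rletter y w).
Proof.
case: w => c [|a s] //=; rewrite /rletter /=; case: ifP => [_|nc] red_as.
  exact: path_sorted red_as.
by rewrite /reduced /= nc.
Qed.

Lemma rletterK y w : reduced w -> rletter (flip y) (rletter y w) = w.
Proof.
case: w => c [|a s]; rewrite /rletter /=; first by rewrite flipK !eqxx.
case: ifP => [/andP[/eqP a1 /eqP c1]|_ _] /=; last by rewrite flipK !eqxx.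
rewrite /reduced c1 -a1; case: a a1 => y' d /= _.
by case: s => [|b s] //= /andP[/negbTE -> _].
Qed.

Lemma rletter_head c a s :
  reduced (c, a :: s) -> rletter a.1 (a.2, s) = (1, a :: s).
Proof.
case: a => y d; case: s => [|b s] //; rewrite /reduced /rletter /=.
by case/andP=> /negbTE ->.
Qed.

Lemma reduced_rmul u v : reduced v -> reduced (rmul u v).
Proof.
move=> red_v; rewrite /rmul reduced_rconst.
by elim: u.2 => //= a s IH; apply: reduced_rletter.
Qed.

Lemma rmul_rconst c u v : rmul (rconst c u) v = rconst c (rmul u v).
Proof. by rewrite /rmul rconstM. Qed.

Lemma rmul_cons c a s v :
  rmul (c, a :: s) v = rconst c (rletter a.1 (rmul (a.2, s) v)).
Proof. by []. Qed.

Lemma rmul_rletter y u v :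
  reduced v -> rmul (rletter y u) v = rletter y (rmul u v).
Proof.
move=> red_v; case: u => c [|a s]; rewrite {1}/rletter.
  by rewrite rmul_cons rconst1.
rewrite [(_, _).1]/= [(_, _).2]/=.
case: ifP => [/andP[/eqP a1 /eqP c1]|_]; last by rewrite [LHS]rmul_cons rconst1.
rewrite c1 rmul_cons rconst1 a1 -{1}[y]flipK rletterK //.
exact: reduced_rmul.
Qed.

Lemma rmulA u v w :
  reduced v -> reduced w -> rmul u (rmul v w) = rmul (rmul u v) w.
Proof.
move=> red_v red_w; case: u => c s; elim: s c => [|a s IH] c.
  by rewrite -[rmul (c, _) v]/(rconst c v) rmul_rconst.
rewrite !rmul_cons rmul_rconst rmul_rletter ?reduced_rmul //.
by rewrite IH.
Qed.

Lemma rmulr1 u : reduced u -> rmul u (1, [::]) = u.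
Proof.
case: u => c s; rewrite /rmul /= => red_u; set w := foldr _ _ _.
suff -> : w = (1, s) by rewrite /rconst mulg1.
rewrite {}/w; elim: s red_u => //= a s IH red_u.
rewrite IH; last exact: path_sorted red_u.
by rewrite /rconst mulg1 (rletter_head red_u).
Qed.

Lemma reduced_rinv u : reduced (rinv u).
Proof.
rewrite /rinv; set w := (_, _); have : reduced w by [].
elim: u.2 w => //= a s IH w red_w; apply: IH.
by rewrite reduced_rconst reduced_rletter.
Qed.

Lemma rmulVr u : reduced u -> rmul (rinv u) u = (1, [::]).
Proof.
move=> red_u; rewrite /rinv; set F := fun _ _ => _.
have mulF w s : rmul (foldl F w s) u = foldl F (rmul w u) s.
  by elim: s w => //= a s IH w; rewrite IH rmul_rconst rmul_rletter.
rewrite mulF /rmul /= /rconst mulVg; case: u red_u {mulF} => c s /=.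
elim: s => //= a s IH red_u; rewrite -[RHS]IH; last exact: path_sorted red_u.
by rewrite {2}/F /rletter /= flipK !eqxx /rconst mulVg.
Qed.

Record freeprod := FreeProd { fpval : rawword; fpvalP : reduced fpval }.

HB.instance Definition _ := [isSub for fpval].
HB.instance Definition _ := [Choice of freeprod by <:].

Definition fpone : freeprod := @FreeProd (1, [::]) isT.
Definition fpmul (u v : freeprod) : freeprod :=
  FreeProd (reduced_rmul (fpval u) (fpvalP v)).
Definition fpinv (u : freeprod) : freeprod := FreeProd (reduced_rinv (fpval u)).

Lemma fpmulA : associative fpmul.
Proof. by move=> u v w; apply/val_inj/rmulA; apply: fpvalP. Qed.
Lemma fpmul1g : left_id fpone fpmul.
Proof. by move=> u; apply/val_inj/rconst1. Qed.
Lemma fpmulg1 : right_id fpone fpmul.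
Proof. by move=> u; apply/val_inj/rmulr1/fpvalP. Qed.
Lemma fpmulVg : left_inverse fpone fpinv fpmul.
Proof. by move=> u; apply/val_inj/rmulVr/fpvalP. Qed.
Lemma fpmulgV : right_inverse fpone fpinv fpmul.
Proof.
move=> u; rewrite -[fpmul u _]fpmul1g -{1}(fpmulVg (fpinv u)) -fpmulA.
by rewrite (fpmulA (fpinv u)) fpmulVg fpmul1g fpmulVg.
Qed.

HB.instance Definition _ :=
  isGroup.Build freeprod fpmulA fpmul1g fpmulg1 fpmulVg fpmulgV.

Definition fpvar (i : 'I_r) : freeprod :=
  @FreeProd (1, [:: ((i, false), 1)]) isT.
Definition fpconst (c : G) : freeprod := @FreeProd (c, [::]) isT.

Lemma fpconst_morph : {morph fpconst : c d / c * d}.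
Proof. by move=> c d; apply: val_inj. Qed.

HB.instance Definition _ :=
  isUMagmaMorphism.Build G freeprod fpconst (erefl, fpconst_morph).

Definition fplen (w : freeprod) : nat := size (fpval w).2.

(* Adjacent letters of the normal form are never mutually inverse, whatever   *)
(* the constant between them.                                                 *)
Definition strong (w : freeprod) : bool :=
  sorted (fun a b : syllable => b.1 != flip a.1) (fpval w).2.

Definition lval (H : groupType) (g : 'I_r -> H) (y : letter) : H :=
  if y.2 then (g y.1)^-1 else g y.1.

Lemma lval_flip H g y : @lval H g (flip y) = (lval g y)^-1.
Proof. by case: y => i []; rewrite /lval //= invgK. Qed.

Lemma fp_normal_form (w : freeprod) :
  w = fpconst (fpval w).1 *
      \prod_(a <- (fpval w).2) (lval fpvar a.1 * fpconst a.2).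
Proof.
have lvalE y : fpval (lval fpvar y) = (1, [:: (y, 1)]).
  by case: y => i []; rewrite /lval //= /fpinv /= /rinv /= /rletter /rconst /=
     invg1 mulg1.
have mulE (u v : freeprod) : fpval (u * v) = rmul (fpval u) (fpval v) by [].
case: w => [[c s] red_w]; apply: val_inj; rewrite -[RHS]/(fpval _) mulE.
set u := \prod_(a <- s) _; suff -> : fpval u = (1, s).
  by rewrite /rmul /rconst /= mulg1.
rewrite {}/u; elim: s red_w => [|a s IH] red_w; first by rewrite big_nil.
have red_s : reduced (1, s) := path_sorted red_w.
rewrite big_cons !mulE IH // lvalE -rmulA // rmul_cons rconst1.
by rewrite /rmul /= rconst1 /rconst /= mulg1 (rletter_head red_w).
Qed.

Lemma fp_normal_form_uniq (c : G) (s : seq syllable) (w : freeprod) :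
    reduced (c, s) ->
    w = fpconst c * \prod_(a <- s) (lval fpvar a.1 * fpconst a.2) ->
  fpval w = (c, s).
Proof. by move=> red_cs ->; rewrite -(fp_normal_form (FreeProd red_cs)). Qed.

Definition rlift (H : groupType) (f : G -> H) (g : 'I_r -> H) (w : rawword) :=
  f w.1 * \prod_(a <- w.2) (lval g a.1 * f a.2).

(* The homomorphism out of the free product induced by f and x_i |-> g i.     *)
Definition fplift (H : groupType) (f : G -> H) (g : 'I_r -> H)
    (w : freeprod) : H :=
  rlift f g (fpval w).

Section Lift.
Variables (H : groupType) (f : UMagmaMorphism.type G H).
Variable g : 'I_r -> H.

Lemma rlift_rconst c w : rlift f g (rconst c w) = f c * rlift f g w.
Proof. by rewrite /rlift gmulfM mulgA. Qed.

Lemma rlift_rletter y w : rlift f g (rletter y w) = lval g y * rlift f g w.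
Proof.
case: w => c [|a s]; rewrite /rletter /rlift /=.
  by rewrite big_seq1 big_nil gmulf1 mul1g mulg1.
case: ifP => [/andP[/eqP a1 /eqP ->]|_] /=; rewrite !big_cons gmulf1 !mul1g /=.
  by rewrite a1 lval_flip !mulgA mulgV mul1g.
by rewrite !mulgA.
Qed.

Lemma fplift_morph : {morph fplift f g : u v / u * v}.
Proof.
move=> u v; rewrite /fplift -[fpval (u * v)]/(rmul (fpval u) (fpval v)).
case: (fpval u) => c s; rewrite {1}/rmul rlift_rconst {2}/rlift -mulgA /=.
congr (_ * _); elim: s => [|a s IH]; first by rewrite big_nil mul1g.
by rewrite big_cons -mulgA /= rlift_rletter rlift_rconst IH !mulgA.
Qed.

Lemma fplift_const c : fplift f g (fpconst c) = f c.
Proof. by rewrite /fplift /rlift big_nil mulg1. Qed.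

Lemma fplift_var i : fplift f g (fpvar i) = g i.
Proof. by rewrite /fplift /rlift big_seq1 /= gmulf1 mul1g mulg1. Qed.

Lemma fplift1 : fplift f g 1 = 1.
Proof. by rewrite -[1 in LHS]/(fpconst 1) fplift_const gmulf1. Qed.

HB.instance Definition _ :=
  isUMagmaMorphism.Build freeprod H (fplift f g) (fplift1, fplift_morph).

Lemma fplift_unique (h : UMagmaMorphism.type freeprod H) :
    (forall c, h (fpconst c) = f c) -> (forall i, h (fpvar i) = g i) ->
  forall w, h w = fplift f g w.
Proof.
move=> hc hx w; rewrite [w in LHS]fp_normal_form gmulfM hc; congr (_ * _).
rewrite gmulf_prod; apply: eq_bigr => a _; rewrite gmulfM hc; congr (_ * _).
by rewrite /lval; case: ifP => _; rewrite ?gmulfV hx.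
Qed.

End Lift.

(* The image of w under the homomorphism that is the identity on G and sends  *)
(* x_i to g i.                                                                *)
Definition word_map (w : freeprod) (g : 'I_r -> G) : G := fplift idfun g w.

End FreeProduct.

Arguments fpvar {r G}.
Arguments fpconst {r G}.

(* Main.v *)
Require Import Defs.
From mathcomp Require Import all_boot all_fingroup.
From mathcomp Require Import zify.

(** Follow a point through the word from left to right.  At each letter its
    image may be prescribed freely, as long as the point has not yet been a
    source and the image has not yet been a target of that letter; strength
    guarantees that the new target does not itself become a forbidden source
    for the next letter.  At the k-th letter this excludes at most 2k - 1
    targets, and at the last letter two admissible targets remain, which give
    two different values of the word map. *)

Set Implicit Arguments.
Unset Strict Implicit.
Unset Printing Implicit Defensive.

Local Open Scope group_scope.

Section PrescribedValues.
Variables (r : nat) (T : finType).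
Implicit Types (g : 'I_r -> {perm T}) (y z : letter r) (A : letter r -> {set T}).

Definition lperm g y : {perm T} := lval g y.

(* [A z] collects the sources of the letter [z] whose images under [g] are
   prescribed; the targets of [z] are the sources of [flip z]. *)
Definition consistent g A := forall z, A (flip z) = lperm g z @: A z.

Definition agree_on A g g' := forall z x, x \in A z -> lperm g' z x = lperm g z x.

(** Sending [p] to [q] by [y] also sends [q] to [p] by [flip y], so both source sets grow. *)
Definition add_pair A y p q z :=
  if z == y then p |: A y else if z == flip y then q |: A (flip y) else A z.

Definition set_letter g y (h : {perm T}) i :=
  if i == y.1 then (if y.2 then h^-1 else h) else g i.

Lemma flip_neq y : (flip y == y) = false.
Proof. by case: y => i []; rewrite xpair_eqE andbF. Qed.

Lemma lperm_flip g y : lperm g (flip y) = (lperm g y)^-1.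
Proof. exact: lval_flip. Qed.

Lemma lperm_set_letter g y h : lperm (set_letter g y h) y = h.
Proof. by case: y => i []; rewrite /lperm /lval /set_letter /= eqxx ?invgK. Qed.

Lemma lperm_set_letter_neq g y h z :
  z != y -> z != flip y -> lperm (set_letter g y h) z = lperm g z.
Proof.
case: y z => i b [j d]; rewrite /lperm /lval /set_letter !xpair_eqE /=.
by case: (j == i) => //=; case: b d => [] [].
Qed.

(* Composing the letter with a transposition redirects [p] to [q] and moves no
   other prescribed value. *)
Lemma exists_add_pair g A y p q :
    consistent g A -> p \notin A y -> q \notin A (flip y) ->
  exists g', [/\ agree_on A g g', consistent g' (add_pair A y p q)
               & lperm g' y p = q].
Proof.
move=> gA pA qA; set h := lperm g y * tperm (lperm g y p) q.
pose g' := set_letter g y h; exists g'.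
have g'y : lperm g' y = h by apply: lperm_set_letter.
have hp : h p = q by rewrite permM tpermL.
have hA x : x \in A y -> h x = lperm g y x.
  (* A prescribed image differs from [lperm g y p] by injectivity, and from [q] because [q] is not
     yet a target; the transposition fixes it. *)
  move=> xA; rewrite permM tpermD //.
    by rewrite (inj_eq perm_inj); apply: contraNneq pA => ->.
  by apply: contraNneq qA => ->; rewrite gA imset_f.
have agr : agree_on A g g'.
  move=> z x; have [-> xA|zy] := eqVneq z y; first by rewrite g'y hA.
  have [->|zfy] := eqVneq z (flip y); last by rewrite lperm_set_letter_neq.
  rewrite {1}gA !lperm_flip g'y => /imsetP[x' x'A ->].
  by rewrite permK -hA // permK.
split=> //; last by rewrite g'y.
have img z : lperm g' z @: A z = A (flip z).
  by rewrite gA; apply: eq_in_imset => x; apply: agr.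
move=> z; rewrite /add_pair -{1}(flipK y) !(inj_eq (inv_inj (@flipK r))).
have [->|zy] := eqVneq z y.
  by rewrite eq_sym flip_neq imsetU1 img g'y hp.
have [->|zfy] := eqVneq z (flip y); last by rewrite img.
by rewrite imsetU1 img flipK lperm_flip g'y -[in RHS]hp permK.
Qed.

Lemma card_add_pair A y p q k z :
  (forall x, #|A x| <= k)%N -> (#|add_pair A y p q z| <= k.+1)%N.
Proof.
move=> Ak; rewrite /add_pair; case: ifP => _; last case: ifP => _.
- by rewrite cardsU1; have := Ak y; lia.
- by rewrite cardsU1; have := Ak (flip y); lia.
- exact: leqW.
Qed.

Lemma agree_on_add_pair A y p q g g' g1 :
    agree_on A g g' -> agree_on (add_pair A y p q) g' g1 ->
  agree_on A g g1 /\ lperm g1 y p = lperm g' y p.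
Proof.
move=> gg' g'g1; split; last by apply: g'g1; rewrite /add_pair eqxx setU11.
move=> z x xA; rewrite -gg' //; apply: g'g1.
by rewrite /add_pair; do 2?case: eqP => [<-|_]; rewrite ?inE ?xA ?orbT.
Qed.

(** Without the leading constant, which does not affect constancy, every suffix of the word has the
    same shape. *)
Definition tail_map g (s : seq (syllable r {perm T})) : {perm T} :=
  \prod_(a <- s) (lperm g a.1 * a.2).

Lemma tail_map_cons g y c s x :
  tail_map g ((y, c) :: s) x = tail_map g s (c (lperm g y x)).
Proof. by rewrite /tail_map big_cons !permM. Qed.

(** Each step of the induction raises [k] by one and shortens [s] by one, so the bound on
    [k + size s] persists. *)
Lemma tail_map_two_values s y c g A p k :
    consistent g A -> (forall z, #|A z| <= k)%N -> p \notin A y ->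
    path (fun a b : syllable r {perm T} => b.1 != flip a.1) (y, c) s ->
    (2 * (k + size s) + 1 < #|T|)%N ->
  exists g1 g2, [/\ agree_on A g g1, agree_on A g g2
    & tail_map g1 ((y, c) :: s) p != tail_map g2 ((y, c) :: s) p].
Proof.
elim: s y c g A p k => [|[y' c'] s IH] y c g A p k gA Ak pA /=.
  move=> _ kn.
  have /card_gt1P[q1 [q2 []]] : (1 < #|~: A (flip y)|)%N.
    rewrite -(ltn_add2l #|A (flip y)|) cardsC; apply: leq_ltn_trans kn.
    by have := Ak (flip y); lia.
  rewrite !inE => q1A q2A q12.
  have [g1 [agr1 _ g1p]] := exists_add_pair gA pA q1A.
  have [g2 [agr2 _ g2p]] := exists_add_pair gA pA q2A.
  exists g1, g2; split=> //.
  by rewrite !tail_map_cons g1p g2p /tail_map !big_nil !perm1 (inj_eq perm_inj).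
case/andP=> y'y path_s kn.
(* As [y' != flip y], the sources of [y'] do not depend on the target [q]. *)
have [q qA cqA] : exists2 q, q \notin A (flip y)
    & c q \notin add_pair A y p q y'.
  set B := if y' == y then p |: A y else A y'.
  have Bk : (#|c @^-1: B| <= k.+1)%N.
    rewrite card_preimset; last exact: perm_inj.
    by rewrite /B; case: ifP; rewrite ?cardsU1; have := Ak y; have := Ak y'; lia.
  (* At most [k] points are already targets and at most [k.+1] are sent by [c] to a source of [y']:
     [2k + 1] exclusions in all. *)
  have /card_gt0P[q] : (0 < #|~: (A (flip y) :|: c @^-1: B)|)%N.
    rewrite -(ltn_add2l #|A (flip y) :|: c @^-1: B|) cardsC addn0.
    apply: leq_ltn_trans kn; rewrite -(leq_add2r #|A (flip y) :&: c @^-1: B|).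
    by rewrite cardsUI; have := Ak (flip y); lia.
  rewrite !inE negb_or => /andP[qA cqB]; exists q => //.
  by rewrite /add_pair (negPf y'y).
have [g' [agr' g'A g'p]] := exists_add_pair gA pA qA.
have [|g1 [g2 [agr1 agr2 neq12]]] :=
  IH y' c' g' _ (c q) k.+1 g'A (fun z => card_add_pair _ _ _ _ Ak) cqA path_s.
  by rewrite addSnnS.
have [agr1' g1p] := agree_on_add_pair agr' agr1.
have [agr2' g2p] := agree_on_add_pair agr' agr2.
by exists g1, g2; rewrite !(tail_map_cons _ y) g1p g2p g'p.
Qed.

End PrescribedValues.

Theorem corollary1 (n r : nat) (hn : (2 <= n)%N) (hr : (1 <= r)%N)
    (w : freeprod r {perm 'I_n}) (w_strong : strong w)
    (w_const : exists c : {perm 'I_n},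
       forall g : 'I_r -> {perm 'I_n}, word_map w g = c) :
  (exists c : {perm 'I_n}, w = fpconst c) \/ (n <= 2 * fplen w)%N.
Proof.
have [|lt_len] := leqP n (2 * fplen w); [by right | left].
case: w w_strong w_const lt_len => [[c0 s] red_w] /= w_strong [c w_const].
rewrite /fplen /= => lt_len.
case: s red_w w_strong w_const lt_len => [|[y d] s] red_w.
  by exists c0; apply: val_inj.
rewrite /strong /= => path_s w_const lt_len.
(* Start at the point 0 with every variable the identity and nothing prescribed, so [k = 0]. *)
have [||||g1 [g2 [_ _ /eqP[]]]] := @tail_map_two_values r 'I_n s y d
    (fun=> 1) (fun=> set0) (Ordinal (ltnW hn)) 0 _ _ _ path_s.
- by move=> z; rewrite imset0.
- by move=> z; rewrite cards0.
- by rewrite inE.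
- by rewrite card_ord; lia.
(* Cancelling [c0] makes the tail constant too, against the two values found. *)
have tailE g : tail_map g ((y, d) :: s) = c0^-1 * c.
  by rewrite -(w_const g) /word_map /fplift /rlift /= mulKg.
by rewrite !tailE.
Qed.
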